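(* Let $m\in\mathbb{N}\setminus\{0\}$. For every $n\in\{1,\ldots,m-1\}$ and $i\in\{1,\ldots,n\}$, let $$a_{i,n}=\frac12\sup_{p\in\mathbb{N}}\left(\beta_{i,n,p}^2+\widetilde\beta_{i,n,p}^2+\eta_{i,n}^2+\sqrt{(\beta_{i,n,p}^2+\widetilde\beta_{i,n,p}^2+\eta_{i,n}^2)^2-4\beta_{i,n,p}^2\eta_{i,n}^2}\right),$$ and for $i\in\{1,\ldots,m\}$ let $\overline a_{i,m}=\sup_{p\in\mathbb{N}}(\beta_{i,m,p}^2+\widetilde\beta_{i,m,p}^2)$. Set $\theta_0=1$ and define $$\theta_n=\sum_{i=1}^n\theta_{i-1}\sqrt{a_{i,n}}\quad(n\in\{1,\ldots,m-1\}),\qquad \overline\theta_m=\sum_{i=1}^m\theta_{i-1}\sqrt{\overline a_{i,m}}.$$ Then the network $\mathcal{X}\times\mathcal{X}\to\mathcal{X}$, with input $(x_0,b_0)$ and output $x_m$, given by $x_n=R_n(W_nx_{n-1}+V_nb_0)$ for $n\in\{1,\ldots,m\}$, is $\overline\theta_m/2^{m-1}$-Lipschitz.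
   Context: $\mathcal{X},\mathcal{Y}$ are real Hilbert spaces of functions on $]0,1[$ (typically $L^2(0,1)$); $T:\mathcal{X}\to\mathcal{Y}$ is a compact linear integral operator $(Tx)(t)=\int_0^1 k(t,s)x(s)\,ds$ with $k\in L^2([0,1]^2)$; $D$ is a bounded linear operator from $\mathcal{X}$ to a real Hilbert space. $T^*T$ and $D^*D$ commute and are diagonalized in a common orthonormal basis $(v_p)_{p\in\mathbb{N}}$ of $\mathcal{X}$, with eigenvalues $(\beta_{T,p})_p$ and $(\beta_{D,p})_p$ respectively. $g:\mathcal{X}\to\,]-\infty,+\infty]$ is proper, lower semicontinuous and convex. For $n\in\{1,\ldots,m\}$, $\lambda_n,\mu_n,\tau_n,\eta_n$ are positive reals. $\mathrm{Id}$ is the identity. The proximity operator is $\mathrm{prox}_{f}(x)=\operatorname{argmin}_{y}\,(f(y)+\frac12\|x-y\|^2)$. $\mathcal{X}\times\mathcal{X}$ carries the norm $\|(x,b)\|=\sqrt{\|x\|^2+\|b\|^2}$. $R_n=\mathrm{prox}_{\lambda_n\mu_ng}$, $W_n=\mathrm{Id}-\lambda_nT^*T-\lambda_n\tau_nD^*D$, $V_n=\lambda_n\eta_{n-1}\cdots\eta_1\mathrm{Id}$ (with $V_1=\lambda_1\mathrm{Id}$). For $1\le i\le n\le m$ and $p\in\mathbb{N}$: $\beta_p^{(n)}=1-\lambda_n(\beta_{T,p}+\tau_n\beta_{D,p})$; $\beta_{i,n,p}=\prod_{j=i}^n\beta_p^{(j)}$; $\eta_{i,j}=\eta_j\cdots\eta_i$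 if $j\ge i$ and $\eta_{i,j}=1$ otherwise; $\widetilde\beta_{i,n,p}=\sum_{j=i}^{n-1}\beta_p^{(n)}\cdots\beta_p^{(j+1)}\lambda_j\eta_{i,j-1}+\lambda_n\eta_{i,n-1}$ (an empty sum is $0$). *)

(* Defs.v *)
From HB Require Import structures.
From mathcomp Require Export all_boot all_order all_algebra.
From mathcomp Require Export all_classical all_reals all_analysis.

Set Implicit Arguments.
Unset Strict Implicit.
Unset Printing Implicit Defensive.

Import Order.TTheory GRing.Theory Num.Theory.
Import numFieldNormedType.Exports.

Local Open Scope classical_set_scope.
Local Open Scope ring_scope.

(* Real Hilbert spaces: definiteness of the inner product follows from
   inner_norm and the axioms of the norm. *)
HB.mixin Record CompleteNormedModule_isHilbert (R : realType) H
    of CompleteNormedModule R H := {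
  inner : H -> H -> R ;
  innerC : forall x y, inner x y = inner y x ;
  inner_linear : forall a x y z,
    inner (a *: x + y) z = a * inner x z + inner y z ;
  inner_norm : forall x, inner x x = `|x| ^+ 2
}.

#[short(type=hilbertType)]
HB.structure Definition Hilbert (R : realType) :=
  {H of CompleteNormedModule_isHilbert R H & CompleteNormedModule R H}.

Section operators.
Context {R : realType}.

Definition bounded_operator {H K : hilbertType R} (f : H -> K) :=
  exists M : R, forall x, `|f x| <= M * `|x|.

Definition compact_operator {H K : hilbertType R} (f : H -> K) :=
  compact (closure (f @` [set x | `|x| <= 1])).

(* The Hilbert adjoint; its values are unique, and they exist (Riesz) when f is
   linear and bounded. *)
Definition adjoint {H K : hilbertType R} (f : H -> K) (y : K) : H :=
  get [set z | forall x, inner (f x) y = inner x z].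

Definition orthonormal_basis {H : hilbertType R} (v : nat -> H) :=
  (forall p q, inner (v p) (v q) = (p == q)%:R) /\
  closure [set x | exists (n : nat) (c : nat -> R),
                     x = \sum_(0 <= p < n) c p *: v p] = setT.

End operators.

Section function_spaces.
Context {R : realType}.

Local Notation mu := (@lebesgue_measure R).
Local Notation I01 := (`]0%R, 1%R[%classic : set R).

(* H is a space of functions on ]0, 1[: F x is a representative of x, functions
   being identified when they agree almost everywhere. *)
Record function_space {H : hilbertType R} (F : H -> R -> R) : Prop := {
  function_space_measurable : forall x, measurable_fun I01 (F x) ;
  function_space_linear : forall a x y,
    ae_eq mu I01 (F (a *: x + y)) (fun t => a * F x t + F y t) ;
  function_space_inj : forall x y, ae_eq mu I01 (F x) (F y) -> x = y
}.

(* k is in L^2([0,1]^2): its extension by zero is in L^2(R^2). *)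
Definition L2_kernel (k : R * R -> R) :=
  (k \_ (`[0, 1] `*` `[0, 1])) \in Lfun (mu \x mu)%E 2%:E.

Definition integral_operator {H K : hilbertType R} (FH : H -> R -> R)
    (FK : K -> R -> R) (k : R * R -> R) (T : H -> K) :=
  forall x, {ae mu, forall t, I01 t ->
    mu.-integrable I01 (fun s => (k (t, s) * FH x s)%:E) /\
    FK (T x) t = \int[mu]_(s in I01) (k (t, s) * FH x s)}.

End function_spaces.

Section convex_analysis.
Context {R : realType} {H : hilbertType R}.
Implicit Type f : H -> \bar R.

(* f takes its values in ]-oo, +oo] and is not identically +oo. *)
Definition proper_efun f :=
  (forall x, f x != -oo%E) /\ (exists x, f x != +oo%E).

Definition convex_efun f := forall (t : R) x y, 0 < t -> t < 1 ->
  (f (t *: x + (1 - t) *: y)%R <= t%:E * f x + (1 - t)%:E * f y)%E.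

Definition argmin f : H := get [set y | forall z, (f y <= f z)%E].

Definition prox f (x : H) : H :=
  argmin (fun y => f y + (2^-1 * `|x - y| ^+ 2)%R%:E)%E.

End convex_analysis.

Section parameters.
Context {R : realType}.
Variables (lambda tau eta : nat -> R) (bT bD : nat -> R).

Definition beta1 (n p : nat) : R := 1 - lambda n * (bT p + tau n * bD p).

Definition beta_prod (i n p : nat) : R := \prod_(i <= j < n.+1) beta1 j p.

Definition eta_prod (i j : nat) : R := \prod_(i <= l < j.+1) eta l.

Definition beta_tilde (i n p : nat) : R :=
  \sum_(i <= j < n) beta_prod j.+1 n p * lambda j * eta_prod i j.-1
  + lambda n * eta_prod i n.-1.

(* The suprema below are over bounded sets as soon as bT and bD are bounded, so
   that the convention sup A = 0 for unbounded A plays no role. *)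
Definition a_coef (i n : nat) : R :=
  2^-1 * sup (range (fun p =>
    let S := beta_prod i n p ^+ 2 + beta_tilde i n p ^+ 2 + eta_prod i n ^+ 2 in
    S + Num.sqrt (S ^+ 2 - 4 * beta_prod i n p ^+ 2 * eta_prod i n ^+ 2))).

Definition abar_coef (i m : nat) : R :=
  sup (range (fun p => beta_prod i m p ^+ 2 + beta_tilde i m p ^+ 2)).

End parameters.

Section network.
Context {R : realType} {X Y Z : hilbertType R}.
Variables (T : X -> Y) (D : X -> Z) (g : X -> \bar R).
Variables (lambda mu tau eta : nat -> R).

Definition layer_R (n : nat) : X -> X :=
  prox (fun x => (lambda n * mu n)%R%:E * g x)%E.

Definition layer_W (n : nat) (x : X) : X :=
  x - lambda n *: adjoint T (T x) - (lambda n * tau n) *: adjoint D (D x).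

Definition layer_V (n : nat) (b : X) : X :=
  (lambda n * eta_prod eta 1 n.-1) *: b.

Fixpoint network_iter (x0 b0 : X) (n : nat) : X :=
  if n is n'.+1 then
    layer_R n (layer_W n (network_iter x0 b0 n') + layer_V n b0)
  else x0.

Definition network (m : nat) (u : X * X) : X := network_iter u.1 u.2 m.

End network.

(* The library's norm on a product is the maximum norm, hence an explicit
   Lipschitz condition for the Euclidean one. *)
Definition hilbert_pair_norm {R : realType} {X : hilbertType R} (u : X * X) : R :=
  Num.sqrt (`|u.1| ^+ 2 + `|u.2| ^+ 2).

Definition lipschitz_pair {R : realType} {X : hilbertType R} (L : R)
    (f : X * X -> X) :=
  forall u v, `|f u - f v| <= L * hilbert_pair_norm (u - v).

(* Main.v *)
(* With [e_n = U_n (x_{n-1}, b_{n-1})], where [b_n = eta_n ... eta_1 b_0] and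
   [U_n (x, b) = (W_n x + lambda_n b, eta_n b)], the network is
   [(x_n, b_n) = (R_n x Id) e_n]. A proximity operator is firmly nonexpansive,
   that is [R_n = (Id + N_n) / 2] with [N_n] nonexpansive, so the differences
   [d_n], [e_n] of two runs satisfy [2 d_n = e_n + q_n] with [|q_n| <= |e_n|]. Unrolling,
   [2^(n-1) e_n] is the sum over [i <= n] of [U_n ... U_i (2^(i-2) q_{i-1})]
   (the term [i = 1] being [U_n ... U_1 d_0]), and [|2^(n-1) e_n| <= theta_n |d_0|]
   follows by induction once the norm of [U_n ... U_i] is known. In the
   eigenbasis this operator splits into the 2 x 2 blocks
   [[beta_{i,n,p}, beta~_{i,n,p}], [0, eta_{i,n}]], whose largest squared
   singular value is the quantity in the definition of [a_{i,n}]; only the first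
   row matters in the last layer, which gives [abar_{i,m}]. *)
Require Import Defs.
From mathcomp Require Import all_boot all_order all_algebra.
From mathcomp Require Import all_classical all_reals all_analysis.
From mathcomp Require Import ring lra.

Import Order.TTheory GRing.Theory Num.Theory.
Import numFieldNormedType.Exports.

Local Open Scope classical_set_scope.
Local Open Scope ring_scope.

(** * Hilbert spaces and proximal points *)

Section inner_product.
Context {R : realType} {H : hilbertType R}.
Implicit Types x y z : H.

Lemma innerDl x y z : inner (x + y) z = inner x z + inner y z.
Proof. by rewrite -[x]scale1r inner_linear mul1r scale1r. Qed.

Lemma inner0l z : inner 0 z = 0.
Proof. by apply: (addrI (inner 0 z)); rewrite -innerDl !addr0. Qed.

Lemma innerZl a x z : inner (a *: x) z = a * inner x z.
Proof. by rewrite -[a *: x]addr0 inner_linear inner0l addr0. Qed.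

Lemma innerNl x z : inner (- x) z = - inner x z.
Proof. by rewrite -scaleN1r innerZl mulN1r. Qed.

Lemma innerDr x y z : inner z (x + y) = inner z x + inner z y.
Proof. by rewrite !(innerC z) innerDl. Qed.

Lemma innerZr a x z : inner z (a *: x) = a * inner z x.
Proof. by rewrite !(innerC z) innerZl. Qed.

Lemma innerNr x z : inner z (- x) = - inner z x.
Proof. by rewrite !(innerC z) innerNl. Qed.

Definition innerE := (innerDl, innerDr, innerNl, innerNr, innerZl, innerZr).

Lemma normsqD x y : `|x + y| ^+ 2 = `|x| ^+ 2 + 2 * inner x y + `|y| ^+ 2.
Proof. by rewrite -!inner_norm !innerE (innerC y x); ring. Qed.

Lemma normsqB x y : `|x - y| ^+ 2 = `|x| ^+ 2 - 2 * inner x y + `|y| ^+ 2.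
Proof. by rewrite normsqD innerNr normrN; ring. Qed.

Lemma normsqZ a x : `|a *: x| ^+ 2 = a ^+ 2 * `|x| ^+ 2.
Proof. by rewrite -!inner_norm !innerE; ring. Qed.

(** Cauchy-Schwarz, obtained by squaring the triangle inequality of the given norm. *)
Lemma inner_le_norm x y : inner x y <= `|x| * `|y|.
Proof.
have : `|x + y| ^+ 2 <= (`|x| + `|y|) ^+ 2.
  by rewrite lerXn2r ?nnegrE ?addr_ge0 // ler_normD.
by rewrite normsqD; lra.
Qed.

Lemma inner_ext x y : (forall z, inner z x = inner z y) -> x = y.
Proof.
move=> e; apply/eqP; rewrite -subr_eq0 -normr_eq0 -sqrf_eq0 -inner_norm.
by rewrite innerDr innerNr e subrr.
Qed.

End inner_product.

(** Continuity of the squared distance: with [p = |x - z|], [q = |x - y|] and [w = |z - y|], moving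
    from [z] to [y] lowers the square by at most [2 w p]. *)
Lemma sqr_ge_of_dist {R : realType} (p q w : R) :
  0 <= p -> 0 <= q -> 0 <= w -> p <= q + w -> p ^+ 2 - 2 * (w * p) <= q ^+ 2.
Proof.
move=> p0 q0 w0 pqw; have [pw|wp] := leP p w.
  have := mulr_ge0 p0 w0; have : 0 <= p * (w - p) by rewrite mulr_ge0 ?subr_ge0.
  by have := sqr_ge0 q; lra.
have : (p - w) ^+ 2 <= q ^+ 2 by rewrite lerXn2r ?nnegrE //; lra.
by have := sqr_ge0 w; lra.
Qed.

(** * Existence of proximal points *)

Section prox_existence.
Context {R : realType} {H : hilbertType R}.
Variable f : H -> \bar R.
Hypotheses (fproper : proper_efun f) (flsc : lower_semicontinuous f)
  (fconvex : convex_efun f).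

(** Brings convexity down to the reals: properness excludes [-oo], and the finite right-hand side
    excludes [+oo]. *)
Lemma convex_efun_fin t x y a b : 0 < t -> t < 1 ->
  f x = a%:E -> f y = b%:E ->
  exists2 c, f (t *: x + (1 - t) *: y) = c%:E & c <= t * a + (1 - t) * b.
Proof.
move=> t0 t1 fx fy; have := fconvex t x y t0 t1.
have := fproper.1 (t *: x + (1 - t) *: y).
rewrite fx fy -!EFinM -EFinD.
by case: (f _) => [c| |] // _; rewrite lee_fin => ?; exists c.
Qed.

Lemma proper_efunP x : f x != +oo%E -> exists r, f x = r%:E.
Proof. by move: (fproper.1 x); case: (f x) => [r| |] // _ _; exists r. Qed.

(* Lower semicontinuity bounds [f] below on a ball around a point of its domain,
   and convexity propagates this bound along the rays from the centre. *)
Lemma convex_lsc_minorant : exists y0 A B, 0 <= A /\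
  forall z r, f z = r%:E -> B - A * `|z - y0| <= r.
Proof.
have [y0 /proper_efunP[r0 fy0]] := fproper.2.
have [V Vy0 fV] : exists2 V, nbhs y0 V &
    forall y, V y -> ((r0 - 1)%:E < f y)%E.
  by apply: flsc; rewrite fy0 lte_fin ltrBlDr ltrDl.
have /nbhs_ballP[e /= e0 eV] := Vy0.
exists y0, (2 / e), (r0 - 1); split; first by rewrite divr_ge0 // ltW.
move=> z r fz; have [ze|ez] := ltP `|z - y0| e.
  have : ((r0 - 1)%:E < f z)%E.
    by apply: fV; apply: eV; rewrite -ball_normE /= distrC.
  rewrite fz lte_fin => /ltW; apply: le_trans.
  by rewrite gerBl mulr_ge0 // divr_ge0 // ltW.
set s := `|z - y0| in ez *.
have s0 : 0 < s by exact: lt_le_trans ez.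
(* With this [t] the point [t *: z + (1 - t) *: y0] lies at distance [e / 2] from [y0], inside the
   ball where [f] exceeds [r0 - 1]. *)
pose t := e / (2 * s).
have t0 : 0 < t by rewrite divr_gt0 // mulr_gt0.
have ts : t * s = e / 2 by rewrite /t; field; rewrite gt_eqF.
have t1 : t < 1 by rewrite ltr_pdivrMr ?mulr_gt0 //; lra.
have [c fc cle] := convex_efun_fin t z y0 r r0 t0 t1 fz fy0.
have : ((r0 - 1)%:E < f (t *: z + (1 - t) *: y0)%R)%E.
  apply: fV; apply: eV; rewrite -ball_normE /= distrC.
  rewrite (_ : _ - _ = t *: (z - y0)); last first.
    by rewrite scalerBl scale1r scalerBr addrA addrAC addrK.
  by rewrite normrZ gtr0_norm // -/s ts; lra.
rewrite fc lte_fin => cgt.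
have -> : 2 / e = t^-1 / s by rewrite /t; field; rewrite !gt_eqF.
rewrite divfK ?gt_eqF // -(ler_pM2l t0) mulrBr divff ?gt_eqF //.
by nra.
Qed.

(** A minimizing sequence is Cauchy because the quadratic term is strongly convex, and lower
    semicontinuity makes its limit a minimizer. *)
Lemma prox_min_exists x : exists z, forall y,
  (f z + (2^-1 * `|x - z| ^+ 2)%R%:E <= f y + (2^-1 * `|x - y| ^+ 2)%R%:E)%E.
Proof.
pose F r y := r + 2^-1 * `|x - y| ^+ 2.
pose E := [set s | exists y r, f y = r%:E /\ s = F r y].
have infE : has_inf E.
  split.
    by have [y0 /proper_efunP[r0 fy0]] := fproper.2; exists (F r0 y0), y0, r0.
  have [y0 [A [B [A0 AB]]]] := convex_lsc_minorant.
  (* Completing the square in [|x - y|] absorbs the linear term of the minorant at the cost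
     [A ^+ 2 / 2]. *)
  exists (B - A * `|x - y0| - A ^+ 2 / 2) => _ [y [r [fy ->]]].
  have := AB _ _ fy; rewrite /F.
  have : `|y - y0| <= `|x - y| + `|x - y0|.
    by rewrite (distrC x y) ler_distD.
  have := sqr_ge0 (`|x - y| - A).
  move: `|y - y0| `|x - y| `|x - y0| => p q s; nra.
set i := inf E.
have Fge r y : f y = r%:E -> i <= F r y.
  by move=> fy; apply: ge_inf; [exact: infE.2|exists y, r].
have /choice[y yP] : forall n : nat, exists y, exists2 r, f y = r%:E &
    F r y < i + n.+1%:R^-1.
  move=> n; have n0 : 0 < n.+1%:R^-1 :> R by rewrite invr_gt0.
  have [_ [y [r [fy ->]]] lt] := inf_adherent n0 infE.
  by exists y, r.
(* parallelogram identity *)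
have mid r1 r2 y1 y2 : f y1 = r1%:E -> f y2 = r2%:E ->
    `|y1 - y2| ^+ 2 <= 4 * ((F r1 y1 - i) + (F r2 y2 - i)).
  move=> f1 f2.
  have h0 : 0 < 2^-1 :> R by rewrite invr_gt0.
  have h1 : 2^-1 < 1 :> R by lra.
  have [c fc cle] := convex_efun_fin _ _ _ _ _ h0 h1 f1 f2.
  have := Fge _ _ fc; rewrite /F.
  have -> : x - (2^-1 *: y1 + (1 - 2^-1) *: y2) =
      2^-1 *: ((x - y1) + (x - y2)).
    rewrite (_ : 1 - 2^-1 = 2^-1 :> R); last by lra.
    rewrite -scalerDr (addrACA x) -opprD [RHS]scalerBr; congr (_ - _).
    by rewrite -[in RHS](scale1r x) -scalerDl scalerA mulVf ?scale1r.
  rewrite normsqZ (_ : y1 - y2 = (x - y2) - (x - y1)); last first.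
    by rewrite opprB [RHS]addrC subrKA.
  rewrite (normsqD (x - y1)) (normsqB (x - y2)) (innerC (x - y2)).
  by move: (inner _ _) (`|x - y1| ^+ 2) (`|x - y2| ^+ 2) => p q s; lra.
have cy : cvg (y @ \oo).
  apply/cauchy_cvgP/cauchy_exP => e e0.
  (* By [mid], the squared distance is at most 4 times the sum of two errors, each below
     [e ^+ 2 / 8]. *)
  have e8 : 0 < e ^+ 2 / 8 by rewrite divr_gt0 // exprn_gt0.
  have [N] := ltr_add_invr e8; rewrite add0r => Ne.
  exists (y N); exists N => // n /= Nn.
  rewrite -ball_normE /=.
  rewrite -(@ltr_pXn2r _ 2) ?nnegrE // ?ltW //.
  have [r1 f1 l1] := yP N; have [r2 f2 l2] := yP n.
  apply: le_lt_trans (mid _ _ _ _ f1 f2) _.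
  have : n.+1%:R^-1 <= N.+1%:R^-1 :> R by rewrite lef_pV2 ?posrE // ler_nat.
  move: Ne l1 l2; move: (F _ _) (F _ _) (n.+1%:R^-1) (N.+1%:R^-1) => F1 F2 a b.
  by move: (e ^+ 2) => E2; lra.
set z := lim (y @ \oo).
(* Semicontinuity is tested against reals [a] below [f z], since [f z] is not yet known to be
   finite. *)
have key a : (a%:E < f z)%E -> a + 2^-1 * `|x - z| ^+ 2 <= i.
  move=> /flsc[V Vz fV]; rewrite leNgt; apply/negP => ai.
  set p := `|x - z| in ai *.
  pose d := a + 2^-1 * p ^+ 2 - i.
  have d0 : 0 < d by rewrite /d; lra.
  have d20 : 0 < d / 2 by lra.
  have p1 : 0 < p + 1 by rewrite ltr_wpDl // normr_ge0.
  (* One half of the excess [d] pays for the error of [y n], the other for replacing [z] by [y n];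
     [p + 1] keeps the radius meaningful when [p = 0]. *)
  have e0 : 0 < d / (2 * (p + 1)).
    by rewrite divr_gt0 // mulr_gt0.
  have [n [Vn dn nd]] : exists n, [/\ V (y n),
      `|z - y n| < d / (2 * (p + 1)) & n.+1%:R^-1 < d / 2].
    near \oo => n; exists n; split.
    - near: n; exact: cy.
    - near: n; exact: (cvgrPdist_lt y z).1 cy _ e0.
    - near: n; exact: (near_infty_natSinv_lt (PosNum d20)).
  have := fV _ Vn; have [r fn rlt] := yP n.
  rewrite fn lte_fin => ar.
  move: rlt; rewrite /F.
  have : p <= `|x - y n| + `|z - y n|.
    by rewrite (distrC z) ler_distD.
  move: dn; rewrite ltr_pdivlMr ?mulr_gt0 //.
  have := normr_ge0 (z - y n); have := normr_ge0 (x - z).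
  have := normr_ge0 (x - y n).
  rewrite -/p; move: `|x - y n| `|z - y n| => q w q0 p0 w0 wlt pq rlt.
  have : p ^+ 2 - 2 * (w * p) <= q ^+ 2.
    exact: sqr_ge_of_dist.
  have : w * p <= w * (p + 1) by rewrite ler_wpM2l ?lerDl.
  rewrite /d in wlt nd; move: nd rlt wlt.
  by move: (n.+1%:R^-1) => k; clearbody i p; lra.
(* At an infinite value [key] would hold for every [a], and the chosen one gives [i + 1 <= i]. *)
have [r fz] : exists r, f z = r%:E.
  apply: proper_efunP; apply/eqP => fz.
  have := key (i - 2^-1 * `|x - z| ^+ 2 + 1); rewrite fz ltry => /(_ isT).
  by lra.
exists z => w; have [/eqP ->|/proper_efunP[s fw]] := boolP (f w == +oo%E).
  by rewrite leey.
rewrite fw fz -!EFinD lee_fin; apply: le_trans (Fge _ _ fw).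
apply/ler_addgt0Pl => e e0.
have := key (r - e); rewrite fz lte_fin gtrBl e0 => /(_ isT).
by lra.
Unshelve. all: by end_near.
Qed.

End prox_existence.

(** First-order optimality condition: after division by [t], letting [t] tend to 0 leaves
    [a <= 0]. *)
Lemma quadratic_tangent_le0 {R : realType} (a b : R) : 0 <= b ->
  (forall t, 0 < t -> t < 1 -> t * a <= t ^+ 2 * b) -> a <= 0.
Proof.
move=> b0 ab; rewrite leNgt; apply/negP => a0.
have c0 : 0 < a + b + 1 by lra.
(* For this [t] the assumption would give [a * (a + b + 1) <= a * b]. *)
have := ab (a / (a + b + 1)); rewrite divr_gt0 // => /(_ isT).
rewrite ltr_pdivrMr // mul1r (_ : a < a + b + 1); last by lra.
move=> /(_ isT).
rewrite expr2 -mulrA ler_pM2l ?divr_gt0 // mulrAC ler_pdivlMr //.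
by nra.
Qed.

(** * Nonexpansiveness of the proximity operator *)

Section prox_theory.
Context {R : realType} {H : hilbertType R}.
Variable f : H -> \bar R.
Hypotheses (fproper : proper_efun f) (flsc : lower_semicontinuous f)
  (fconvex : convex_efun f).

Lemma prox_min x y : (f (prox f x) + (2^-1 * `|x - prox f x| ^+ 2)%R%:E <=
  f y + (2^-1 * `|x - y| ^+ 2)%R%:E)%E.
Proof.
have [z zmin] := prox_min_exists _ fproper flsc fconvex x.
have P : [set y | forall z, (f y + (2^-1 * `|x - y| ^+ 2)%R%:E <=
  f z + (2^-1 * `|x - z| ^+ 2)%R%:E)%E] z by [].
exact: (getI P y).
Qed.

Lemma prox_fin x : exists r, f (prox f x) = r%:E.
Proof.
apply: (proper_efunP _ fproper); apply/eqP => fp.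
have [y /(proper_efunP _ fproper)[r fy]] := fproper.2.
by have := prox_min x y; rewrite fp fy -EFinD addye // leye_eq.
Qed.

(** The residual [x - prox f x] is a subgradient of [f] at [prox f x]: compare the minimizer with
    the points of the segment towards [z] and keep the first order in [t]. *)
Lemma prox_variational x z r s : f (prox f x) = r%:E -> f z = s%:E ->
  inner (x - prox f x) (z - prox f x) <= s - r.
Proof.
set p := prox f x => fp fz; rewrite -subr_le0.
apply: (@quadratic_tangent_le0 _ _ (2^-1 * `|z - p| ^+ 2)).
  by rewrite mulr_ge0 // invr_ge0.
move=> t t0 t1.
have [c fc cle] := convex_efun_fin _ fproper fconvex _ _ _ _ _ t0 t1 fz fp.
have := prox_min x (t *: z + (1 - t) *: p).
rewrite -/p fp fc -!EFinD lee_fin.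
have -> : x - (t *: z + (1 - t) *: p) = (x - p) - t *: (z - p).
  by rewrite scalerBl scale1r addrCA -scalerBr opprD addrA.
by rewrite (normsqB (x - p)) normsqZ innerZr; lra.
Qed.

(* Firm nonexpansiveness, in the form: the reflection [2 prox - Id] is
   nonexpansive. *)
Lemma prox_reflection_nonexpansive x y :
  `|2 *: (prox f x - prox f y) - (x - y)| <= `|x - y|.
Proof.
have [r fp] := prox_fin x; have [s fq] := prox_fin y.
(* The two inequalities add up to [|p - q|^2 <= <p - q, x - y>], which is the claim once the square
   is expanded. *)
have := prox_variational _ _ _ _ fp fq; have := prox_variational _ _ _ _ fq fp.
set p := prox f x; set q := prox f y => h1 h2.
rewrite -(@ler_pXn2r _ 2) ?nnegrE // normsqB normsqZ innerZl.
rewrite -inner_norm; move: h1 h2; rewrite !innerE.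
rewrite (innerC q p) (innerC x p) (innerC x q) (innerC y p) (innerC y q).
by lra.
Qed.

Lemma prox_nonexpansive x y : `|prox f x - prox f y| <= `|x - y|.
Proof.
have := prox_reflection_nonexpansive x y.
set d := prox f x - prox f y; set e := x - y => h.
have : `|2 *: d| <= `|2 *: d - e| + `|e|.
  by rewrite -{1}(subrK e (2 *: d)) ler_normD.
by rewrite normrZ gtr0_norm //; lra.
Qed.

End prox_theory.

Lemma scaled_proper {R : realType} {H : hilbertType R} (g : H -> \bar R) (c : R) :
  0 < c -> proper_efun g -> proper_efun (fun x => c%:E * g x)%E.
Proof.
move=> c0 gp; split=> [x|].
  have := gp.1 x; case: (g x) => [r| |] // _.
  by rewrite gt0_muley ?lte_fin.
have [x /(proper_efunP _ gp)[r gx]] := gp.2.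
by exists x; rewrite gx -EFinM.
Qed.

Lemma scaled_lsc {R : realType} {H : hilbertType R} (g : H -> \bar R) (c : R) :
  0 < c -> lower_semicontinuous g -> lower_semicontinuous (fun x => c%:E * g x)%E.
Proof.
have scaleE (a d : R) (z : \bar R) : 0 < d ->
    (a%:E < d%:E * z)%E = ((a / d)%:E < z)%E.
  by move=> d0; rewrite EFinM lte_pdivrMr // muleC.
move=> c0 glsc x a; rewrite scaleE // => /glsc[V Vx gV].
by exists V => // y /gV; rewrite scaleE.
Qed.

Lemma scaled_convex {R : realType} {H : hilbertType R} (g : H -> \bar R) (c : R) :
  0 < c -> proper_efun g -> convex_efun g ->
  convex_efun (fun x => c%:E * g x)%E.
Proof.
move=> c0 gp gc t x y t0 t1.
apply: (@le_trans _ _ (c%:E * (t%:E * g x + (1 - t)%:E * g y)))%E.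
  by rewrite lee_pmul2l // gc.
have u0 : 0 < 1 - t by lra.
rewrite muleDr //; first by rewrite !muleA -!EFinM (mulrC c) (mulrC c).
(* The sum distributed over is well defined: neither term can be [-oo]. *)
have := gp.1 x; have := gp.1 y.
case: (g x) => [r| |] //; case: (g y) => [s| |] // _ _;
  by rewrite ?gt0_muley ?lte_fin // -?EFinM.
Qed.

(** * Adjoints *)

Lemma bounded_operator_ge0 {R : realType} {H K : hilbertType R} (f : H -> K) :
  bounded_operator f -> exists2 M, 0 <= M & forall x, `|f x| <= M * `|x|.
Proof.
move=> [M fM]; exists `|M| => // x.
by apply: le_trans (fM x) _; rewrite ler_wpM2r // ler_norm.
Qed.

Section adjoint_theory.
Context {R : realType} {H K : hilbertType R}.
Variable T : {linear H -> K}.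
Hypothesis Tbounded : bounded_operator T.

(* Riesz representation: the representative minimizes
   [x |-> |x|^2 / 2 - <T x, y>], so that its existence is an instance of that of
   the proximal point. *)
Lemma adjoint_exists y : exists z, forall x, inner (T x) y = inner x z.
Proof.
have [M M0 TM] := bounded_operator_ge0 _ Tbounded.
pose f x : \bar R := (- inner (T x) y)%:E.
have fproper : proper_efun f by split=> //; exists 0.
have flsc : lower_semicontinuous f.
  move=> x a; rewrite lte_fin => ax.
  (* A Lipschitz constant of the functional, made positive so that one can divide by it. *)
  pose C := M * `|y| + 1.
  have C0 : 0 < C by rewrite ltr_wpDl // mulr_ge0.
  pose e := (- inner (T x) y - a) / C.
  have e0 : 0 < e by rewrite divr_gt0 // subr_gt0.
  exists (ball x e); first exact: nbhsx_ballx.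
  move=> z; rewrite -ball_normE /= distrC ltr_pdivlMr // => ze.
  rewrite lte_fin.
  have := inner_le_norm (T (z - x)) y.
  rewrite linearB innerDl innerNl => h.
  have : `|T z - T x| * `|y| <= M * `|z - x| * `|y|.
    by rewrite ler_wpM2r // -linearB TM.
  have : 0 <= `|z - x| by [].
  by rewrite /C in ze; nra.
have fconvex : convex_efun f.
  move=> t u w t0 t1; rewrite /f -!EFinM -EFinD lee_fin.
  by rewrite linearD !linearZ /= innerDl !innerZl; lra.
have [z zmin] := prox_min_exists _ fproper flsc fconvex 0.
(* Optimality gives only an inequality; applied to [x] and to [- x] it becomes the equality. *)
have half x : inner (T x) y - inner x z <= 0.
  apply: (@quadratic_tangent_le0 _ _ (2^-1 * `|x| ^+ 2)).
    by rewrite mulr_ge0 // invr_ge0.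
  move=> t t0 t1; have := zmin (z + t *: x).
  rewrite /f -!EFinD lee_fin !sub0r !normrN linearD linearZ /=.
  by rewrite innerDl innerZl normsqD normsqZ innerZr (innerC z); lra.
exists z => x; have := half x; have := half (- x).
by rewrite linearN !innerNl; lra.
Qed.

Lemma adjointP x y : inner (T x) y = inner x (adjoint T y).
Proof.
have [z zP] := adjoint_exists y.
have P : [set z | forall x, inner (T x) y = inner x z] z by [].
exact: (getI P x).
Qed.

Lemma adjoint_comp_linear : linear (fun x => adjoint T (T x)).
Proof.
move=> a x y; apply: inner_ext => z.
by rewrite -adjointP linearD linearZ /= !innerE !adjointP.
Qed.

(** With [w] the image of [x], [|w|^2 = <T w, T x> <= M^2 |w| |x|]. *)
Lemma adjoint_comp_bounded : bounded_operator (fun x => adjoint T (T x)).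
Proof.
have [M M0 TM] := bounded_operator_ge0 _ Tbounded; exists (M ^+ 2) => x.
set w := adjoint T (T x).
have [->|w0] := eqVneq w 0; first by rewrite normr0 mulr_ge0 ?sqr_ge0.
rewrite -(@ler_pM2l _ `|w|) ?normr_gt0 // -expr2 -inner_norm {2}/w -adjointP.
apply: le_trans (inner_le_norm _ _) _.
apply: le_trans (ler_pM _ _ (TM w) (TM x)) _ => //.
by rewrite -subr_ge0; set s := _ - _; have -> : s = 0 by rewrite /s; ring.
Qed.

End adjoint_theory.

(** A compact set is bounded, so [T] is bounded on the unit ball, and homogeneity extends the
    bound. *)
Lemma compact_operator_bounded {R : realType} {H K : hilbertType R}
  (T : {linear H -> K}) : compact_operator T -> bounded_operator T.
Proof.
move=> /compact_bounded/pinfty_ex_gt0[M M0 TM]; exists M => x.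
have [->|x0] := eqVneq x 0; first by rewrite linear0 !normr0 mulr0.
have xn : 0 < `|x| by rewrite normr_gt0.
rewrite -ler_pdivrMr // mulrC -[`|x|^-1]gtr0_norm ?invr_gt0 // -normrZ -linearZ.
apply: TM; apply: subset_closure; exists (`|x|^-1 *: x) => //=.
by rewrite normrZ gtr0_norm ?invr_gt0 // mulVf ?gt_eqF.
Qed.

(** * Diagonal operators *)

Section bounded_families.
Context {R : realType}.
Implicit Types (a b : nat -> R).

(** The condition under which [sup (range a)] is a genuine upper bound. *)
Definition bounded_family a := exists M, forall p, `|a p| <= M.

Lemma boundedD a b : bounded_family a -> bounded_family b ->
  bounded_family (fun p => a p + b p).
Proof.
move=> [M aM] [N bN]; exists (M + N) => p.
by rewrite (le_trans (ler_normD _ _)) // lerD.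
Qed.

Lemma boundedM a b : bounded_family a -> bounded_family b ->
  bounded_family (fun p => a p * b p).
Proof.
by move=> [M aM] [N bN]; exists (M * N) => p; rewrite normrM ler_pM.
Qed.

Lemma bounded_family_le_sup a p : bounded_family a -> a p <= sup (range a).
Proof.
move=> [M aM]; apply: ub_le_sup; last by exists p.
by exists M => _ [q _ <-]; apply: le_trans (ler_norm _) (aM q).
Qed.

Lemma bounded_family_le a b : (forall p, 0 <= a p <= b p) ->
  bounded_family b -> bounded_family a.
Proof.
move=> ab [M bM]; exists M => p; have /andP[a0 le] := ab p.
by rewrite ger0_norm // (le_trans le) // (le_trans (ler_norm _)).
Qed.

End bounded_families.

(* The left-hand side is the squared norm of the image of [(c, d)] under the
   matrix [[x, y], [0, h]], whose Gram matrix has trace [S] and determinant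
   [x^2 h^2]; the factor on the right is its largest eigenvalue. *)
Lemma block_matrix_bound {R : realType} (x y h c d : R) :
  let S := x ^+ 2 + y ^+ 2 + h ^+ 2 in
  (x * c + y * d) ^+ 2 + (h * d) ^+ 2 <=
    2^-1 * (S + Num.sqrt (S ^+ 2 - 4 * x ^+ 2 * h ^+ 2)) * (c ^+ 2 + d ^+ 2).
Proof.
cbv zeta; set S := _ + _ + h ^+ 2; set D := S ^+ 2 - _.
have D0 : 0 <= D.
  have -> : D = (x ^+ 2 - h ^+ 2) ^+ 2 + y ^+ 2 * (y ^+ 2 + 2 * (x ^+ 2 + h ^+ 2)).
    by rewrite /D /S; ring.
  have x0 := sqr_ge0 x; have y0 := sqr_ge0 y; have h0 := sqr_ge0 h.
  by rewrite addr_ge0 ?sqr_ge0 // mulr_ge0 // addr_ge0 // mulr_ge0 // addr_ge0.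
have := sqr_sqrtr D0; have := sqrtr_ge0 D.
move: (Num.sqrt D) => w w0 wD.
(* As [s] is a root of the characteristic polynomial, [s] times the identity minus the Gram matrix
   has determinant 0 ([prodE]); its trace is nonnegative ([sumE]), so it is positive
   semidefinite. *)
set s := 2^-1 * (S + w).
have prodE : (s - x ^+ 2) * (s - y ^+ 2 - h ^+ 2) = (x * y) ^+ 2.
  have wE : w = 2 * s - S by rewrite /s; lra.
  by rewrite wE in wD; move: wD; rewrite /D /S; clearbody s; lra.
have sumE : 0 <= (s - x ^+ 2) + (s - y ^+ 2 - h ^+ 2).
  by rewrite /s /S; lra.
have A0 : 0 <= s - x ^+ 2.
  rewrite leNgt; apply/negP => A0.
  have B0 : 0 < s - y ^+ 2 - h ^+ 2 by lra.
  have : (s - x ^+ 2) * (s - y ^+ 2 - h ^+ 2) < 0 by rewrite nmulr_rlt0.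
  by rewrite prodE ltNge sqr_ge0.
have B0 : 0 <= s - y ^+ 2 - h ^+ 2.
  rewrite leNgt; apply/negP => B0.
  have A1 : 0 < s - x ^+ 2 by lra.
  have : (s - x ^+ 2) * (s - y ^+ 2 - h ^+ 2) < 0 by rewrite pmulr_rlt0.
  by rewrite prodE ltNge sqr_ge0.
rewrite -subr_ge0.
have -> : s * (c ^+ 2 + d ^+ 2) - ((x * c + y * d) ^+ 2 + (h * d) ^+ 2) =
  (s - x ^+ 2) * c ^+ 2 - 2 * (x * y) * (c * d)
  + (s - y ^+ 2 - h ^+ 2) * d ^+ 2 by ring.
move: (s - x ^+ 2) (s - y ^+ 2 - h ^+ 2) (x * y) prodE A0 B0 => A B z AB A0 B0.
have [A1|] := ltP 0 A.
  rewrite -(pmulr_rge0 _ A1).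
  have -> : A * (A * c ^+ 2 - 2 * z * (c * d) + B * d ^+ 2) =
    (A * c - z * d) ^+ 2 + (A * B - z ^+ 2) * d ^+ 2 by ring.
  by rewrite AB subrr mul0r addr0 sqr_ge0.
move=> A1; have A2 : A = 0 by apply/le_anti; rewrite A1 A0.
move: AB; rewrite A2 mul0r => /esym/eqP; rewrite sqrf_eq0 => /eqP ->.
by rewrite mulr0 !mul0r subrr add0r mulr_ge0 ?sqr_ge0.
Qed.

(** * The Euclidean norm on the product *)

Section pair_norm.
Context {R : realType} {X : hilbertType R}.
Implicit Types u w : X * X.
Local Notation pnorm := (@hilbert_pair_norm R X).

Lemma pnorm_ge0 u : 0 <= pnorm u.
Proof. exact: sqrtr_ge0. Qed.

Lemma pnorm_sqr u : pnorm u ^+ 2 = `|u.1| ^+ 2 + `|u.2| ^+ 2.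
Proof. by rewrite sqr_sqrtr // addr_ge0 ?sqr_ge0. Qed.

Lemma pnorm_le u (c : R) : 0 <= c ->
  (pnorm u <= c) = (`|u.1| ^+ 2 + `|u.2| ^+ 2 <= c ^+ 2).
Proof.
by move=> c0; rewrite -(@ler_pXn2r _ 2) ?nnegrE ?pnorm_ge0 // pnorm_sqr.
Qed.

Lemma norm_fst_le u : `|u.1| <= pnorm u.
Proof.
rewrite -(@ler_pXn2r _ 2) ?nnegrE ?pnorm_ge0 // pnorm_sqr.
by rewrite lerDl sqr_ge0.
Qed.

Lemma norm_snd_le u : `|u.2| <= pnorm u.
Proof.
rewrite -(@ler_pXn2r _ 2) ?nnegrE ?pnorm_ge0 // pnorm_sqr.
by rewrite lerDr sqr_ge0.
Qed.

Lemma pnorm_le_sum u : pnorm u <= `|u.1| + `|u.2|.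
Proof.
rewrite pnorm_le ?addr_ge0 //.
have := mulr_ge0 (normr_ge0 u.1) (normr_ge0 u.2).
by move: `|u.1| `|u.2| => a b; lra.
Qed.

Lemma pnormZ (c : R) u : pnorm (c *: u) = `|c| * pnorm u.
Proof.
rewrite /hilbert_pair_norm /= !normrZ !exprMn -mulrDr sqrtrM ?sqr_ge0 //.
by rewrite sqrtr_sqr normr_id.
Qed.

Lemma pnormD u w : pnorm (u + w) <= pnorm u + pnorm w.
Proof.
rewrite pnorm_le ?addr_ge0 ?pnorm_ge0 //=.
(* Cauchy-Schwarz in the plane, by the Lagrange identity. *)
have cs : `|u.1| * `|w.1| + `|u.2| * `|w.2| <= pnorm u * pnorm w.
  rewrite -(@ler_pXn2r _ 2) ?nnegrE ?addr_ge0 ?mulr_ge0 ?pnorm_ge0 //.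
  rewrite exprMn !pnorm_sqr -subr_ge0.
  set l := _ - _; have -> : l = (`|u.1| * `|w.2| - `|u.2| * `|w.1|) ^+ 2.
    by rewrite /l; ring.
  exact: sqr_ge0.
have h1 : `|u.1 + w.1| ^+ 2 <= (`|u.1| + `|w.1|) ^+ 2.
  by rewrite lerXn2r ?nnegrE ?addr_ge0 // ler_normD.
have h2 : `|u.2 + w.2| ^+ 2 <= (`|u.2| + `|w.2|) ^+ 2.
  by rewrite lerXn2r ?nnegrE ?addr_ge0 // ler_normD.
by have := pnorm_sqr u; have := pnorm_sqr w; lra.
Qed.

Lemma pnorm0 : pnorm 0 = 0.
Proof. by rewrite -(scale0r (0 : X * X)) pnormZ normr0 mul0r. Qed.

Lemma pnorm_sum (r : seq nat) (F : nat -> X * X) :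
  pnorm (\sum_(i <- r) F i) <= \sum_(i <- r) pnorm (F i).
Proof.
elim/big_ind2: _ => [|a b c d ab cd|//]; first by rewrite pnorm0.
by apply: le_trans (pnormD _ _) (lerD ab cd).
Qed.

End pair_norm.

(** * Operators diagonal in the basis and their norms *)

Section diagonal_operators.
Context {R : realType} {X : hilbertType R}.
Variable v : nat -> X.
Hypothesis vbasis : orthonormal_basis v.

(** Linearity and boundedness accompany the eigenvalues so that density of the span carries
    estimates over to the whole space. *)
Record diagonal (A : X -> X) (a : nat -> R) : Prop := {
  diagonal_linear : linear A ;
  diagonal_bounded : bounded_operator A ;
  diagonal_eigen : forall p, A (v p) = a p *: v p
}.

Lemma basis_norm p : `|v p| = 1.
Proof.
by apply/eqP; rewrite -sqrp_eq1 // -inner_norm vbasis.1 eqxx.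
Qed.

Lemma diagonal_id : diagonal id (fun=> 1).
Proof.
split=> [a x y //| |p]; last by rewrite scale1r.
by exists 1 => x; rewrite mul1r.
Qed.

Lemma diagonal_comp A a B b : diagonal A a -> diagonal B b ->
  diagonal (fun x => A (B x)) (fun p => a p * b p).
Proof.
move=> [Al [M AM] Ae] [Bl [N BN] Be]; split=> [c x y| |p].
- by rewrite Bl Al.
- exists (`|M| * N) => x; rewrite -mulrA.
  apply: le_trans (AM _) _; apply: le_trans (ler_wpM2r _ (ler_norm M)) _ => //.
  by rewrite ler_wpM2l.
- have A0 : A 0 = 0.
    by have := Al (-1) 0 0; rewrite !scaleN1r oppr0 add0r addNr.
  by rewrite Be -[b p *: v p]addr0 Al A0 addr0 Ae scalerA mulrC.
Qed.

Lemma diagonalZD (c : R) A a B b : diagonal A a -> diagonal B b ->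
  diagonal (fun x => c *: A x + B x) (fun p => c * a p + b p).
Proof.
move=> [Al [M AM] Ae] [Bl [N BN] Be]; split=> [d x y| |p].
- rewrite Al Bl !scalerDr !scalerA (mulrC c) -!addrA; congr (_ + _).
  by rewrite addrCA.
- exists (`|c| * M + N) => x; rewrite mulrDl.
  rewrite (le_trans (ler_normD _ _)) // lerD // normrZ -mulrA.
  by rewrite ler_wpM2l.
- by rewrite Ae Be scalerA scalerDl.
Qed.

Lemma diagonal_bounded_family A a : diagonal A a -> bounded_family a.
Proof.
move=> [_ [M AM] Ae]; exists M => p.
by have := AM (v p); rewrite Ae normrZ basis_norm !mulr1.
Qed.

Lemma diagonal_sum A a n (c : nat -> R) : diagonal A a ->
  A (\sum_(0 <= p < n) c p *: v p) = \sum_(0 <= p < n) (a p * c p) *: v p.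
Proof.
move=> [Al _ Ae]; elim: n => [|n IH].
  by rewrite !big_geq //; have := Al (-1) 0 0; rewrite !scaleN1r oppr0 add0r addNr.
by rewrite !big_nat_recr //= addrC Al IH Ae scalerA addrC mulrC.
Qed.

Lemma parseval n (c : nat -> R) :
  `|\sum_(0 <= p < n) c p *: v p| ^+ 2 = \sum_(0 <= p < n) c p ^+ 2.
Proof.
have orth k N : (N <= k)%N -> inner (\sum_(0 <= p < N) c p *: v p) (v k) = 0.
  elim: N => [|N IH] Nk; first by rewrite big_geq // inner0l.
  rewrite big_nat_recr //= innerDl IH ?(ltnW Nk) // innerZl vbasis.1.
  by rewrite (ltn_eqF Nk) mulr0 addr0.
elim: n => [|n IH]; first by rewrite !big_geq // normr0 expr0n.
rewrite !big_nat_recr //= normsqD IH innerZr orth // mulr0 mulr0 addr0.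
by rewrite normsqZ basis_norm expr1n mulr1.
Qed.

Lemma span_dense x (e : R) : 0 < e ->
  exists n (c : nat -> R), `|x - \sum_(0 <= p < n) c p *: v p| < e.
Proof.
move=> e0; have : closure [set x | exists (n : nat) (c : nat -> R),
    x = \sum_(0 <= p < n) c p *: v p] x by rewrite vbasis.2.
move=> /(_ (ball x e) (nbhsx_ballx _ _ e0))[y [[n [c ->]]]].
by rewrite -ball_normE /= => xe; exists n, c.
Qed.

(** Padding with zeros gives two finite combinations a common length, so that their coefficients can
    be paired. *)
Lemma span_pad n N (c : nat -> R) : (n <= N)%N ->
  \sum_(0 <= p < n) c p *: v p =
  \sum_(0 <= p < N) (if (p < n)%N then c p else 0) *: v p.
Proof.
move=> nN; rewrite [RHS](big_cat_nat (n := n)) //= [X in _ = _ + X]big1_seq ?addr0.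
  by apply: eq_big_nat => p /andP[_ ->].
move=> p; rewrite mem_index_iota => /andP[_ /andP[np _]].
by rewrite ltnNge np /= scale0r.
Qed.

Definition block (A B : X -> X) (h : R) (u : X * X) : X * X :=
  (A u.1 + B u.2, h *: u.2).

(** On finite combinations the operator acts on each pair of coefficients separately, and Parseval
    sums the bounds; density and continuity do the rest. *)
Lemma block_norm_le A a B b (h s : R) (u : X * X) :
  diagonal A a -> diagonal B b -> 0 <= s ->
  (forall p c d,
     (a p * c + b p * d) ^+ 2 + (h * d) ^+ 2 <= s * (c ^+ 2 + d ^+ 2)) ->
  hilbert_pair_norm (block A B h u) <= Num.sqrt s * hilbert_pair_norm u.
Proof.
move=> dA dB s0 hs.
have dense_case w n1 c1 n2 c2 : w = (\sum_(0 <= p < n1) c1 p *: v p,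
    \sum_(0 <= p < n2) c2 p *: v p) ->
    hilbert_pair_norm (block A B h w) <= Num.sqrt s * hilbert_pair_norm w.
  have [N [c [d [-> ->]]]] : exists N c d,
      \sum_(0 <= p < n1) c1 p *: v p = \sum_(0 <= p < N) c p *: v p /\
      \sum_(0 <= p < n2) c2 p *: v p = \sum_(0 <= p < N) d p *: v p.
    exists (maxn n1 n2); do 2!eexists; split; apply: span_pad.
      by rewrite leq_maxl.
    by rewrite leq_maxr.
  move=> ->.
  rewrite pnorm_le ?mulr_ge0 ?sqrtr_ge0 //=.
  rewrite (diagonal_sum _ _ _ _ dA) (diagonal_sum _ _ _ _ dB).
  rewrite scaler_sumr -big_split /=.
  under eq_bigr do rewrite -scalerDl.
  under [X in _ + `|X| ^+ 2]eq_bigr do rewrite scalerA.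
  rewrite !parseval exprMn sqr_sqrtr // pnorm_sqr /= !parseval.
  by rewrite -!big_split /= mulr_sumr; apply: ler_sum.
have [M M0 AM] := bounded_operator_ge0 _ (diagonal_bounded _ _ dA).
have [N N0 BN] := bounded_operator_ge0 _ (diagonal_bounded _ _ dB).
(* A crude bound on the block operator, used only to control the approximation error. *)
pose C := M + N + `|h|.
have blockC w : hilbert_pair_norm (block A B h w) <= C * hilbert_pair_norm w.
  apply: le_trans (pnorm_le_sum _) _; rewrite /C mulrDl /= lerD //; last first.
    by rewrite normrZ ler_wpM2l // norm_snd_le.
  rewrite mulrDl (le_trans (ler_normD _ _)) // lerD //.
    by apply: le_trans (AM _) _; rewrite ler_wpM2l // norm_fst_le.
  by apply: le_trans (BN _) _; rewrite ler_wpM2l // norm_snd_le.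
have C0 : 0 <= C by rewrite !addr_ge0.
apply/ler_addgt0Pl => e e0.
(* Chosen so that the total error [(C + Num.sqrt s) * (2 * (e / K))] is at most [e]. *)
pose K := 2 * (C + Num.sqrt s) + 1.
have K0 : 0 < K by rewrite ltr_wpDl // mulr_ge0 // addr_ge0 // sqrtr_ge0.
have eK : 0 < e / K by rewrite divr_gt0.
have [n1 [c1 h1]] := span_dense u.1 _ eK.
have [n2 [c2 h2]] := span_dense u.2 _ eK.
set w := (\sum_(0 <= p < n1) c1 p *: v p, \sum_(0 <= p < n2) c2 p *: v p).
have bw := dense_case w _ _ _ _ erefl.
have uw : hilbert_pair_norm (u - w) <= 2 * (e / K).
  by apply: le_trans (pnorm_le_sum _) _; rewrite /= mulr2n mulrDl mul1r lerD // ltW.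
have wu : hilbert_pair_norm w <= hilbert_pair_norm u + hilbert_pair_norm (u - w).
  have {1}-> : w = u + (-1) *: (u - w) by rewrite scaleN1r opprB addrC subrK.
  by apply: le_trans (pnormD _ _) _; rewrite pnormZ normrN1 mul1r.
have bu : hilbert_pair_norm (block A B h u) <=
    hilbert_pair_norm (block A B h w) + hilbert_pair_norm (block A B h (u - w)).
  have {1}-> : block A B h u = block A B h w + block A B h (u - w).
    have addA (L : X -> X) : linear L -> forall x y : X, L y = L x + L (y - x).
      by move=> Ll x y; rewrite -[X in _ = _ + X]scale1r addrC -Ll scale1r subrK.
    rewrite /block (addA _ (diagonal_linear _ _ dA) w.1 u.1).
    rewrite (addA _ (diagonal_linear _ _ dB) w.2 u.2).
    apply/pair_equal_spec; split; first by rewrite addrACA.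
    by rewrite /= -scalerDr addrC subrK.
  exact: pnormD.
apply: le_trans bu _; apply: le_trans (lerD bw (blockC _)) _.
have : Num.sqrt s * hilbert_pair_norm w <=
    Num.sqrt s * (hilbert_pair_norm u + hilbert_pair_norm (u - w)).
  by rewrite ler_wpM2l ?sqrtr_ge0.
have : (C + Num.sqrt s) * hilbert_pair_norm (u - w) <= e.
  apply: (@le_trans _ _ ((C + Num.sqrt s) * (2 * (e / K)))).
    by rewrite ler_wpM2l ?addr_ge0 ?sqrtr_ge0.
  rewrite mulrA mulrA ler_pdivrMr // /K; move: (Num.sqrt s) => q.
  by clearbody C; lra.
by clearbody C; lra.
Qed.

End diagonal_operators.

(** * The network *)

Section unrolling.
Context {V : zmodType}.
Variable U : nat -> V -> V.
Hypothesis Uadd : forall n, {morph U n : x y / x + y}.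

(* [U n \o ... \o U i] for [i <= n] *)
Fixpoint layer_comp (i n : nat) (u : V) : V :=
  if n is n'.+1 then U n'.+1 (if (i <= n')%N then layer_comp i n' u else u)
  else u.

Fixpoint perturbed (Q : nat -> V) (n : nat) : V :=
  if n is n'.+1 then U n'.+1 (perturbed Q n' + Q n') else 0.

(** Discrete variation of constants: by additivity, the source [Q i.-1] is propagated independently
    through the layers [i] to [n]. *)
Lemma perturbedE Q n :
  perturbed Q n = \sum_(1 <= i < n.+1) layer_comp i n (Q i.-1).
Proof.
elim: n => [|n IH]; first by rewrite big_geq.
have U0 : U n.+1 0 = 0 by apply: (addrI (U n.+1 0)); rewrite -Uadd !addr0.
rewrite big_nat_recr //= ltnn Uadd IH (big_morph _ (Uadd n.+1) U0).
by congr (_ + _); apply: eq_big_nat => i /andP[_]; rewrite ltnS => ->.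
Qed.

End unrolling.

(** * Spectral description and norms of composed layers *)

Section network_layers.
Context {R : realType} {X Y Z : hilbertType R}.
Variables (T : {linear X -> Y}) (D : {linear X -> Z}) (v : nat -> X).
Variables (bT bD lambda tau eta : nat -> R).
Hypotheses (Tbounded : bounded_operator T) (Dbounded : bounded_operator D).
Hypothesis vbasis : orthonormal_basis v.
Hypothesis Teigen : forall p, adjoint T (T (v p)) = bT p *: v p.
Hypothesis Deigen : forall p, adjoint D (D (v p)) = bD p *: v p.

Local Notation W := (layer_W T D lambda tau).
Local Notation beta1 := (beta1 lambda tau bT bD).
Local Notation beta_prod := (beta_prod lambda tau bT bD).
Local Notation beta_tilde := (beta_tilde lambda tau eta bT bD).
Local Notation eta_prod := (eta_prod eta).

Lemma eq_diagonal (A A' : X -> X) (a a' : nat -> R) :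
  A =1 A' -> a =1 a' -> diagonal v A a -> diagonal v A' a'.
Proof. by move=> /funext-> /funext->. Qed.

Lemma layer_W_diagonal n : diagonal v (W n) (beta1 n).
Proof.
have dT : diagonal v (fun x => adjoint T (T x)) bT.
  by split; [exact: adjoint_comp_linear|exact: adjoint_comp_bounded|].
have dD : diagonal v (fun x => adjoint D (D x)) bD.
  by split; [exact: adjoint_comp_linear|exact: adjoint_comp_bounded|].
apply: eq_diagonal (diagonalZD _ (- (lambda n * tau n)) _ _ _ _ dD
  (diagonalZD _ (- lambda n) _ _ _ _ dT (diagonal_id v))) => [x|p].
  by rewrite /layer_W !scaleNr addrC; congr (_ - _); rewrite addrC.
by rewrite /Defs.beta1; ring.
Qed.

Definition layer_U (n : nat) : X * X -> X * X :=
  block (W n) (fun b => lambda n *: b) (eta n).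

Lemma layer_W_add n : {morph W n : x y / x + y}.
Proof.
move=> x y; have := diagonal_linear _ _ _ (layer_W_diagonal n) 1 x y.
by rewrite !scale1r.
Qed.

Lemma layer_U_add n : {morph layer_U n : x y / x + y}.
Proof.
move=> x y; rewrite /layer_U /block /= layer_W_add !scalerDr.
by apply/pair_equal_spec; split; rewrite //= addrACA.
Qed.

Lemma layer_UZ n (c : R) u : layer_U n (c *: u) = c *: layer_U n u.
Proof.
have W0 : W n 0 = 0.
  by apply: (addrI (W n 0)); rewrite -layer_W_add !addr0.
have WZ x : W n (c *: x) = c *: W n x.
  have := diagonal_linear _ _ _ (layer_W_diagonal n) c x 0.
  by rewrite W0 !addr0.
apply/pair_equal_spec; split; rewrite /= ?WZ ?scalerDr !scalerA.
  by rewrite (mulrC c).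
by rewrite (mulrC c).
Qed.

Lemma beta_prodS i n p : (i <= n.+1)%N ->
  beta_prod i n.+1 p = beta1 n.+1 p * beta_prod i n p.
Proof. by move=> hin; rewrite /Defs.beta_prod big_nat_recr //= mulrC. Qed.

Lemma eta_prodS i n : (i <= n.+1)%N ->
  eta_prod i n.+1 = eta n.+1 * eta_prod i n.
Proof. by move=> hin; rewrite /Defs.eta_prod big_nat_recr //= mulrC. Qed.

(** The upper right entry of the product of the block of layer [n.+1] with that of the layers [i] to
    [n]. *)
Lemma beta_tildeS i n p : (i <= n)%N ->
  beta_tilde i n.+1 p = beta1 n.+1 p * beta_tilde i n p
                        + lambda n.+1 * eta_prod i n.
Proof.
move=> hin; rewrite /Defs.beta_tilde; congr (_ + _).
(* The new summand [j = n] is the image of the separate last term of [beta_tilde i n p]. *)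
rewrite big_nat_recr //= mulrDr mulr_sumr; congr (_ + _).
  apply: eq_big_nat => j /andP[_ jn].
  by rewrite beta_prodS 1?ltnW // !mulrA.
by rewrite beta_prodS // {1}/Defs.beta_prod big_geq // mulr1 mulrA.
Qed.

Lemma layer_comp_block i n : (1 <= i <= n)%N -> exists A B,
  [/\ diagonal v A (beta_prod i n), diagonal v B (beta_tilde i n) &
      forall u, layer_comp layer_U i n u = block A B (eta_prod i n) u].
Proof.
case/andP=> i1; elim: n => [|n IH]; first by rewrite leqNgt i1.
rewrite leq_eqVlt => /orP[/eqP ->|].
  (* The null term [0 *: b] fits the homothety to the shape of [diagonalZD]. *)
  exists (W n.+1), (fun b => lambda n.+1 *: b + 0 *: b); split.
  - apply: eq_diagonal (layer_W_diagonal n.+1) => // p.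
    by rewrite /Defs.beta_prod big_nat1.
  - apply: eq_diagonal (diagonalZD _ (lambda n.+1) _ _ _ _ (diagonal_id v)
      (diagonalZD _ (-1) _ _ _ _ (diagonal_id v) (diagonal_id v))) => [x|p] /=.
      by rewrite scaleN1r addNr scale0r.
    rewrite /Defs.beta_tilde big_geq // /Defs.eta_prod big_geq //.
    by rewrite !mulr1 addNr add0r addr0.
  - by move=> u /=; rewrite ltnn /layer_U /block /Defs.eta_prod big_nat1 scale0r addr0.
rewrite ltnS => hin; have [A [B [dA dB AB]]] := IH hin.
exists (fun x => W n.+1 (A x)),
  (fun x => (lambda n.+1 * eta_prod i n) *: x + W n.+1 (B x)); split.
- apply: eq_diagonal (diagonal_comp _ _ _ _ _ (layer_W_diagonal n.+1) dA) => // p.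
  by rewrite beta_prodS // ltnW.
- apply: eq_diagonal (diagonalZD _ _ _ _ _ _ (diagonal_id v)
    (diagonal_comp _ _ _ _ _ (layer_W_diagonal n.+1) dB)) => // p.
  by rewrite beta_tildeS // mulr1 addrC.
- move=> u /=; rewrite hin AB /layer_U /block /= layer_W_add.
  rewrite eta_prodS 1?ltnW // !scalerA -addrA; congr (_ + _, _).
  by rewrite addrC.
Qed.

(** Eigenvalues of a bounded operator are bounded, so the suprema in [a_coef] and [abar_coef] are
    taken over bounded sets. *)
Lemma beta_bounded i n : (1 <= i <= n)%N ->
  bounded_family (beta_prod i n) /\ bounded_family (beta_tilde i n).
Proof.
move=> /layer_comp_block[A [B [dA dB _]]].
by split; [exact: (diagonal_bounded_family _ vbasis _ _ dA)
          |exact: (diagonal_bounded_family _ vbasis _ _ dB)].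
Qed.

Lemma layer_comp_norm i n u : (1 <= i <= n)%N ->
  hilbert_pair_norm (layer_comp layer_U i n u) <=
  Num.sqrt (a_coef lambda tau eta bT bD i n) * hilbert_pair_norm u.
Proof.
move=> hin; have [A [B [dA dB ->]]] := layer_comp_block i n hin.
have [bA bB] := beta_bounded i n hin.
rewrite /a_coef; set phi := fun p => _.
have phi_sup p : 0 <= phi p <= sup (range phi).
  rewrite /phi /=; set S := fun p => beta_prod i n p ^+ 2 + beta_tilde i n p ^+ 2
    + eta_prod i n ^+ 2.
  have S0 q : 0 <= S q by rewrite /S !addr_ge0 ?sqr_ge0.
  rewrite addr_ge0 ?sqrtr_ge0 ?S0 //=.
  apply: (@bounded_family_le_sup _ phi).
  (* The radicand is at most [S ^+ 2], hence [phi] is dominated by [2 S]. *)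
  apply: (@bounded_family_le _ _ (fun p => S p + S p)) => [q|].
    rewrite /phi /= addr_ge0 ?sqrtr_ge0 ?S0 //= lerD2l.
    rewrite -[leRHS](ger0_norm (S0 q)) -sqrtr_sqr ler_wsqrtr // gerBl.
    by rewrite -mulrA mulr_ge0 // mulr_ge0 ?sqr_ge0.
  have bS : bounded_family S.
    apply: boundedD; last by exists `|eta_prod i n ^+ 2|.
    by apply: boundedD; exact: boundedM.
  exact: boundedD.
apply: (block_norm_le _ vbasis _ _ _ _ _ _ _ dA dB).
  by rewrite mulr_ge0 ?invr_ge0 //; have /andP[] := phi_sup 0%N; exact: le_trans.
move=> p c d; apply: le_trans (block_matrix_bound _ _ _ _ _) _.
rewrite ler_wpM2r ?addr_ge0 ?sqr_ge0 // ler_pM2l ?invr_gt0 //.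
by have /andP[] := phi_sup p.
Qed.

(** Replacing the lower entry by 0 leaves the first component unchanged, and a single row obeys
    Cauchy-Schwarz. *)
Lemma layer_comp_fst_norm i n u : (1 <= i <= n)%N ->
  `|(layer_comp layer_U i n u).1| <=
  Num.sqrt (abar_coef lambda tau eta bT bD i n) * hilbert_pair_norm u.
Proof.
move=> hin; have [A [B [dA dB ->]]] := layer_comp_block i n hin.
have [bA bB] := beta_bounded i n hin.
apply: le_trans (norm_fst_le (block A B 0 u)) _.
rewrite /abar_coef; set phi := fun p => _.
have phi_sup p : phi p <= sup (range phi).
  by apply: bounded_family_le_sup; apply: boundedD; exact: boundedM.
apply: (block_norm_le _ vbasis _ _ _ _ _ _ _ dA dB).
  by apply: le_trans (phi_sup 0%N); rewrite addr_ge0 ?sqr_ge0.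
move=> p c d; rewrite mul0r expr0n addr0.
apply: (@le_trans _ _ (phi p * (c ^+ 2 + d ^+ 2))).
  rewrite /phi -subr_ge0; set l := _ - _.
  have -> : l = (beta_prod i n p * d - beta_tilde i n p * c) ^+ 2.
    by rewrite /l; ring.
  exact: sqr_ge0.
by rewrite ler_wpM2r ?addr_ge0 ?sqr_ge0.
Qed.

End network_layers.

Theorem proposition3p9 (R : realType) (X Y Z : hilbertType R)
    (FX : X -> R -> R) (FY : Y -> R -> R) (k : R * R -> R)
    (T : {linear X -> Y}) (D : {linear X -> Z})
    (v : nat -> X) (bT bD : nat -> R) (g : X -> \bar R)
    (m : nat) (lambda mu tau eta theta : nat -> R)
    (hX : function_space FX) (hY : function_space FY)
    (hk : L2_kernel k) (hTk : integral_operator FX FY k T)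
    (hT : compact_operator T) (hD : bounded_operator D)
    (hcomm : forall x, adjoint T (T (adjoint D (D x))) =
                       adjoint D (D (adjoint T (T x))))
    (hv : orthonormal_basis v)
    (hbT : forall p, adjoint T (T (v p)) = bT p *: v p)
    (hbD : forall p, adjoint D (D (v p)) = bD p *: v p)
    (hg_proper : proper_efun g) (hg_lsc : lower_semicontinuous g)
    (hg_convex : convex_efun g)
    (hm : (0 < m)%N)
    (hlambda : forall n, (1 <= n <= m)%N -> 0 < lambda n)
    (hmu : forall n, (1 <= n <= m)%N -> 0 < mu n)
    (htau : forall n, (1 <= n <= m)%N -> 0 < tau n)
    (heta : forall n, (1 <= n <= m)%N -> 0 < eta n)
    (htheta0 : theta 0%N = 1)
    (htheta : forall n, (1 <= n <= m.-1)%N ->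
       theta n = \sum_(1 <= i < n.+1)
         theta i.-1 * Num.sqrt (a_coef lambda tau eta bT bD i n)) :
  let theta_bar := \sum_(1 <= i < m.+1)
    theta i.-1 * Num.sqrt (abar_coef lambda tau eta bT bD i m) in
  lipschitz_pair (theta_bar / 2 ^+ m.-1)
    (network T D g lambda mu tau eta m).
Proof.
move=> theta_bar u w.
have Tb := compact_operator_bounded _ hT.
pose U := layer_U T D lambda tau eta.
have Uadd n : {morph U n : x y / x + y} by exact: (layer_U_add _ _ v bT bD).
have UZ n c y : U n (c *: y) = c *: U n y by exact: (layer_UZ _ _ v bT bD).
pose x n := network_iter T D g lambda mu tau eta u.1 u.2 n.
pose y n := network_iter T D g lambda mu tau eta w.1 w.2 n.
pose d n : X * X := (x n - y n, eta_prod eta 1 n *: (u.2 - w.2)).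
pose L n (z b : X) := layer_W T D lambda tau n z + layer_V lambda eta n b.
have xS n : x n.+1 = layer_R g lambda mu n.+1 (L n.+1 (x n) u.2) by [].
have yS n : y n.+1 = layer_R g lambda mu n.+1 (L n.+1 (y n) w.2) by [].
(* The augmented layer maps a difference of states to the difference of the inputs of the proximity
   operator. *)
have Ud n : U n.+1 (d n) = (L n.+1 (x n) u.2 - L n.+1 (y n) w.2,
    eta_prod eta 1 n.+1 *: (u.2 - w.2)).
  apply/pair_equal_spec; split; last by rewrite /= eta_prodS // scalerA.
  have WB := layer_W_add T D v bT bD lambda tau Tb hD hbT hbD n.+1 (y n) (x n - y n).
  rewrite addrC subrK in WB.
  rewrite /L WB /layer_V /= scalerA scalerBr.
  move: (layer_W _ _ _ _ _ (x n - y n)) (layer_W _ _ _ _ _ (y n)) => p q.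
  by rewrite opprD addrACA (addrC q) addrK.
(* [E n] is [2^(n-1) e_n] for [n >= 1], and [E 0 = 0], so that [Q 0 = d 0] and [Q n] is
   [2^(n-1) q_n] afterwards. *)
pose E := fix E n : X * X :=
  if n is n'.+1 then U n'.+1 (2 ^+ n' *: d n') else 0.
pose Q n := 2 ^+ n *: d n - E n.
have EP n : E n = perturbed U Q n.
  by elim: n => [//|n IH] /=; rewrite -IH /Q addrC subrK.
have pc n : (1 <= n <= m)%N -> 0 < lambda n * mu n.
  by move=> hn; rewrite mulr_gt0 ?hlambda ?hmu.
have ES n : E n.+1 = 2 ^+ n *: U n.+1 (d n) by rewrite /= UZ.
(* In the first component [2 d_n - e_n] is a difference of reflections; in the second, where no
   proximity operator acts, [d_n] and [e_n] agree. *)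
have QE n : (1 <= n <= m)%N -> hilbert_pair_norm (Q n) <= hilbert_pair_norm (E n).
  case: n => // n /pc c0; rewrite /Q ES exprSr -scalerA -scalerBr !pnormZ.
  rewrite ler_wpM2l // Ud pnorm_le ?pnorm_ge0 // pnorm_sqr /=.
  rewrite xS yS lerD //.
    rewrite lerXn2r ?nnegrE //.
    exact: (prox_reflection_nonexpansive _ (scaled_proper _ _ c0 hg_proper)
      (scaled_lsc _ _ c0 hg_lsc) (scaled_convex _ _ c0 hg_proper hg_convex)).
  by rewrite scaler_nat mulr2n addrK.
have d0 : d 0%N = u - w by rewrite /d /eta_prod big_geq // scale1r.
have theta_ge0 n : (n <= m.-1)%N -> 0 <= theta n.
  elim/ltn_ind: n => -[|n] IH hn; first by rewrite htheta0.
  rewrite htheta // big_nat; apply: sumr_ge0 => -[//|i] /andP[_ hi].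
  by rewrite mulr_ge0 ?sqrtr_ge0 // IH // (leq_trans _ hn) // ltnW.
(* Strong induction: [|Q n| <= |E n|], and unrolling [E n] bounds it by the earlier [|Q i.-1|] with
   the weights of the recursion of [theta]. *)
have Qn n : (n <= m.-1)%N ->
    hilbert_pair_norm (Q n) <= theta n * hilbert_pair_norm (u - w).
  elim/ltn_ind: n => -[|n] IH hn.
    by rewrite /Q /= subr0 scale1r d0 htheta0 mul1r.
  have hnm : (n.+1 <= m)%N by rewrite (leq_trans hn) // leq_pred.
  apply: le_trans (QE _ _) _ => //.
  rewrite EP perturbedE // htheta // mulr_suml.
  apply: le_trans (pnorm_sum _ _) _; rewrite !big_nat.
  apply: ler_sum => -[//|i] /andP[_ hi].
  apply: le_trans (layer_comp_norm _ _ _ _ _ _ _ _ Tb hD hv hbT hbD _ _ _ _) _ => //.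
  rewrite [leRHS]mulrAC mulrC ler_wpM2r ?sqrtr_ge0 //=.
  by apply: IH => //; rewrite (leq_trans _ hn) // ltnW.
have [n mE] : exists n, m = n.+1 by exists m.-1; rewrite prednK.
have c0 : 0 < lambda m * mu m by apply: pc; rewrite hm leqnn.
(* The last layer uses plain nonexpansiveness without doubling, hence the exponent [m.-1], and only
   a first component remains to be bounded. *)
have step : `|x m - y m| <= `|(U m (d m.-1)).1|.
  rewrite mE succnK Ud [(_, _).1]/= xS yS -mE.
  exact: (prox_nonexpansive _ (scaled_proper _ _ c0 hg_proper)
      (scaled_lsc _ _ c0 hg_lsc) (scaled_convex _ _ c0 hg_proper hg_convex)).
apply: le_trans step _.
have p2 : 0 < 2 ^+ m.-1 :> R by rewrite exprn_gt0.
rewrite mulrAC ler_pdivlMr // mulrC -{1}(gtr0_norm p2) -normrZ.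
have -> : 2 ^+ m.-1 *: (U m (d m.-1)).1 = (E m).1 by rewrite mE ES.
rewrite EP perturbedE // /theta_bar mulr_suml raddf_sum.
apply: le_trans (ler_norm_sum _ _ _) _; rewrite !big_nat.
apply: ler_sum => -[//|i] /andP[_ hi].
apply: le_trans
  (layer_comp_fst_norm _ _ _ _ _ _ _ _ Tb hD hv hbT hbD _ _ _ _) _ => //.
rewrite [leRHS]mulrAC mulrC ler_wpM2r ?sqrtr_ge0 //=.
by apply: Qn; rewrite mE /= -ltnS -mE.
Qed.
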